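(* Let $G$ be a connected Lie group and $H\subset G$ a closed, compact, connected subgroup, with $p_0=H\in G/H$. Let $f\in L^\infty(G/H)$, let $S\subset G/H$ be non-empty and define $k_S:G/H\to\mathbb{R}\cup\{\infty\}$ by $k_S(p)=0$ if $p\in S$ and $k_S(p)=\infty$ otherwise. Then for all $p\in G/H$: $$-\left(k_S\,\square_G\,(-f)\right)(p)=\sup_{g\in G:\;g^{-1}p\in S}f(gp_0).$$
   Context: $G/H$ is the space of left cosets with the action $g(g'H)=(gg')H$. Morphological group convolution: for $f\in L^\infty(G/H)$ (evaluated pointwise) and $k:G/H\to\mathbb{R}\cup\{\infty\}$ not everywhere $\infty$, $(k\,\square_G\,f)(p)=\inf_{g\in G}\{k(g^{-1}p)+f(gp_0)\}$. *)

(* Defs.v *)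
From HB Require Import structures.
From mathcomp Require Import all_boot all_order all_algebra.
From mathcomp Require Import all_classical all_reals all_analysis.
Set Implicit Arguments.
Unset Strict Implicit.
Unset Printing Implicit Defensive.
Import Order.TTheory GRing.Theory Num.Theory.
Import numFieldNormedType.Exports.
Local Open Scope classical_set_scope.
Local Open Scope ring_scope.

(* [U] is meant to be open. In finite dimension, asking that all directional
   derivatives be of class C^k is the same as asking this of the Frechet
   derivative. *)
Fixpoint class_C (R : realType) (V W : normedModType R) (k : nat)
    (U : set V) (f : V -> W) : Prop :=
  if k is k'.+1 then
    (forall x, U x -> differentiable f x) /\
    (forall v, class_C k' U (fun x => 'D_v f x))
  else forall x, U x -> {for x, continuous f}.

Definition smooth_on (R : realType) (V W : normedModType R)
    (U : set V) (f : V -> W) : Prop := forall k, class_C k U f.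

(* A homeomorphism from an open subset of [T] onto an open subset of R^n; the
   values of [chart_map] off [chart_dom], and those of [chart_inv] off the
   image of [chart_dom], are irrelevant. *)
Record chart (R : realType) (n : nat) (T : topologicalType) := Chart {
  chart_dom : set T;
  chart_map :> T -> 'rV[R]_n;
  chart_inv : 'rV[R]_n -> T;
  chart_dom_open : open chart_dom;
  chart_img_open : open (chart_map @` chart_dom);
  chart_mapK : forall x, chart_dom x -> chart_inv (chart_map x) = x;
  chart_map_continuous :
    forall x, chart_dom x -> {for x, continuous chart_map};
  chart_inv_continuous :
    forall u, (chart_map @` chart_dom) u -> {for u, continuous chart_inv}
}.

HB.mixin Record isLieGroup (R : realType) (n : nat) G
    of Group G & Topological G := {
  lie_atlas : set (chart R n G);
  lie_hausdorff : hausdorff_space G;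
  lie_second_countable : @second_countable G;
  lie_atlas_cover : forall x : G, exists2 c, lie_atlas c & chart_dom c x;
  lie_atlas_compatible : forall c d, lie_atlas c -> lie_atlas d ->
    smooth_on (c @` (chart_dom c `&` chart_dom d)) (d \o chart_inv c);
  lie_mul_continuous : continuous (fun z : G * G => (z.1 * z.2)%g);
  lie_mul_smooth : forall b c d,
    lie_atlas b -> lie_atlas c -> lie_atlas d ->
    smooth_on
      [set (b z.1, c z.2) | z in [set z : G * G |
         [/\ chart_dom b z.1, chart_dom c z.2 & chart_dom d (z.1 * z.2)%g]]]
      (fun u => d (chart_inv b u.1 * chart_inv c u.2)%g);
  lie_inv_continuous : continuous (fun x : G => x^-1%g);
  lie_inv_smooth : forall c d, lie_atlas c -> lie_atlas d ->
    smooth_on (c @` [set x | chart_dom c x /\ chart_dom d x^-1%g])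
      (fun u => d (chart_inv c u)^-1%g)
}.

#[short(type="lieGroupType")]
HB.structure Definition LieGroup (R : realType) (n : nat) :=
  {G of Group G & Topological G & isLieGroup R n G}.

Section Coset.
Context (R : realType) (n : nat) (G : lieGroupType R n) (H : groupClosed G).
Local Open Scope quotient_scope.

Definition coset_rel : rel G := fun x y => (x^-1 * y)%g \in H.

Lemma coset_rel_equiv : equiv_class_of coset_rel.
Proof.
split=> [x | x y | y x z]; rewrite /coset_rel.
- by rewrite mulVg gpred1.
- by rewrite -(gpredV H (x^-1 * y)%g) invgM invgK.
- by move=> xy yz; rewrite -(mulVKg y z) mulgA gpredM.
Qed.

Canonical coset_equiv := EquivRelPack coset_rel_equiv.

Definition coset_space : Type := quotient_topology {eq_quot coset_equiv}.

HB.instance Definition _ := Topological.on coset_space.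

Definition coset_of_elt (g : G) : coset_space := \pi g.

Definition base_coset : coset_space := coset_of_elt 1%g.

HB.instance Definition _ := isPointed.Build coset_space base_coset.

Definition coset_act (g : G) (p : coset_space) : coset_space :=
  coset_of_elt (g * repr p)%g.

Lemma coset_actE (g x : G) :
  coset_act g (coset_of_elt x) = coset_of_elt (g * x)%g.
Proof.
have /eqmodP : repr (coset_of_elt x) = x %[mod {eq_quot coset_equiv}].
  by rewrite [LHS]reprK.
rewrite /= /coset_rel => rx; apply/eqmodP.
by rewrite /= /coset_rel invgM -mulgA mulKg.
Qed.

Definition borel_coset_space := g_sigma_algebraType (@open coset_space).

(* As G/H is locally compact, Hausdorff and second countable, finiteness on
   compact sets makes [mu] a Radon measure. It is then unique up to a positive
   factor, so that the essentially bounded functions do not depend on it. *)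
Definition invariant_radon
    (mu : {measure set borel_coset_space -> \bar R}) : Prop :=
  [/\ forall (g : G) (A : set borel_coset_space), measurable A ->
        mu (coset_act g @` A) = mu A,
      forall K : set coset_space, compact K -> (mu K < +oo)%E
    & (0 < mu setT)%E].

(* [k] takes values in R `|` {+oo}; it is never used with the value -oo. *)
Definition morph_conv (k : coset_space -> \bar R) (f : coset_space -> R)
    (p : coset_space) : \bar R :=
  ereal_inf [set (k (coset_act g^-1%g p)
                  + (f (coset_act g base_coset))%:E)%E | g in [set: G]].

Definition flat_kernel (S : set coset_space) (p : coset_space) : \bar R :=
  if p \in S then 0%E else +oo%E.

End Coset.

(* Main.v *)
Require Import Defs.
From HB Require Import structures.
From mathcomp Require Import all_boot all_order all_algebra.
From mathcomp Require Import all_classical all_reals all_analysis.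
Set Implicit Arguments.
Unset Strict Implicit.
Unset Printing Implicit Defensive.
Import Order.TTheory GRing.Theory Num.Theory.
Import numFieldNormedType.Exports.
Local Open Scope classical_set_scope.
Local Open Scope ring_scope.

(** Negation turns the infimum into a supremum of the values [-(k_S(g^-1 p) - f(g p0))]. Such a
    value is [f(g p0)] when [g^-1 p] lies in [S], and [-oo] otherwise, so the remaining [g] cannot
    raise the supremum. *)

Theorem proposition6p1 (R : realType) (n : nat) (G : lieGroupType R n)
    (H : groupClosed G)
    (G_connected : connected [set: G])
    (H_closed : closed [set` H]) (H_compact : compact [set` H])
    (H_connected : connected [set` H])
    (mu : {measure set (borel_coset_space H) -> \bar R})
    (mu_inv : invariant_radon mu)
    (f : coset_space H -> R)
    (f_Linfty : (f : borel_coset_space H -> R) \in Lfun mu +oo%E)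
    (S : set (coset_space H)) (S_nonempty : S !=set0)
    (p : coset_space H) :
  (- morph_conv (flat_kernel S) (fun q => (- f q)%R) p)%E =
  ereal_sup [set (f (coset_act g (base_coset H)))%:E
            | g in [set g : G | S (coset_act g^-1%g p)]].
Proof.
(* [ereal_inf] unfolds to minus the supremum of the negated set, so the two signs cancel and two
   suprema remain to be compared. *)
rewrite /morph_conv /ereal_inf oppeK; apply/eqP; rewrite eq_le.
apply/andP; split; apply: ge_ereal_sup => y /=.
- move=> [_ [g _ <-] <-]; rewrite /flat_kernel; case: ifPn => [/set_mem Sg | _].
  + by rewrite add0e -EFinN opprK; apply: ereal_sup_ubound; exists g.
  (* Off [S] the kernel is [+oo]; adding the finite [- f] keeps it so, and negation gives [-oo],
     below any bound. *)
  + by rewrite addye// leNye.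
- move=> [g Sg <-]; apply: ereal_sup_ubound.
  (* The value before negation: for [g^-1 p] in [S] the kernel contributes [0]. *)
  exists (- f (coset_act g (base_coset H)))%:E; last by rewrite -EFinN opprK.
  by exists g => //; rewrite /flat_kernel mem_set// add0e.
Qed.
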